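(* Let $(\mu,\widetilde x)=(\mu,Wz)$ be a Ritz pair and let $C(\lambda)=Z_\perp^HB(\lambda)Z_\perp$. Assume that $\mu$ is a simple eigenvalue of $B(\cdot)$ and $\sigma_{\min}(C(\lambda_* ))>0$. Then the Ritz vector $\widetilde x$ is unique and $$\sin\angle(\widetilde x,x_* )\leq\left(1+\frac{\|T(\lambda_* )\|}{\sqrt{1-\varepsilon^2}\,\sigma_{\min}(C(\lambda_* ))}\right)\varepsilon+\frac{\|T'(\lambda_* )\||\mu-\lambda_*|}{\sigma_{\min}(C(\lambda_* ))}+O(|\mu-\lambda_*|^2).$$
   Context: $\Omega\subseteq\mathbb{C}$ is a connected open set and $T:\Omega\to\mathbb{C}^{n\times n}$ is an analytic matrix-valued function that is regular, i.e. $\det T(\lambda)$ is not identically zero on $\Omega$. $(\lambda_*,x_* )$ is a simple eigenpair of $T$: $\lambda_*\in\Omega$ is a simple root of $\det T(\lambda)=0$, $T(\lambda_* )x_*=0$ and $\|x_*\|=1$. $\|\cdot\|$ is the 2-norm, $H$ denotes conjugate transpose, and $\sigma_{\min}$ is the smallest singular value. $\mathcal{W}\subset\mathbb{C}^n$ is an $m$-dimensional subspace taken from a sequence of subspaces, $W\in\mathbb{C}^{n\times m}$ has orthonormal columns spanning $\mathcal{W}$, $B(\lambda)=W^HT(\lambda)W$, and $\varepsilon=\sin\angle(x_*,\mathcal{W})=\|(I-WW^H)x_*\|$, where it is assumed that $\varepsilon\to0$ as $\mathcal{W}$ changes (so $\varepsilon<1$). An eigenpair $(\mu,z)$ of $B$,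 i.e. $\mu\in\Omega$, $B(\mu)z=0$, $\|z\|=1$, with $\mu$ selected to approximate $\lambda_*$, gives the Ritz value $\mu$ and the Ritz vector $\widetilde x=Wz$. $Z_\perp\in\mathbb{C}^{m\times(m-1)}$ is such that $(z\ \ Z_\perp)$ is unitary. $\mu$ is simple if it is a simple root of $\det B(\lambda)=0$. Uniqueness of a unit-length vector is understood up to a scalar factor of modulus one. $\angle(\cdot,\cdot)$ is the acute angle between the lines spanned by two nonzero vectors. $O(\cdot)$ is understood as $\mu\to\lambda_*$. *)

(* Defs.v *)
From HB Require Import structures.
From mathcomp Require Import all_boot all_order all_algebra.
From mathcomp Require Import all_classical all_reals all_analysis.
From mathcomp Require Import complex.

Set Implicit Arguments.
Unset Strict Implicit.
Unset Printing Implicit Defensive.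

Import Order.TTheory GRing.Theory Num.Theory.
Import numFieldNormedType.Exports.

Local Open Scope classical_set_scope.
Local Open Scope complex_scope.
Local Open Scope ring_scope.

(* R[i] carries no topology by itself; the copy R[i]^o is the normed module
   over which limits and complex derivatives are taken.  The modulus is the
   real-valued one, normc : R[i] -> R. *)
Notation cmod := ComplexField.Normc.normc.

Definition adjmx {R : realType} {m n : nat} (A : 'M[R[i]]_(m, n)) :
  'M[R[i]]_(n, m) := map_mx Num.conj A^T.

Definition unitary {R : realType} {m n : nat} (U : 'M[R[i]]_(m, n)) : Prop :=
  adjmx U *m U = 1%:M /\ U *m adjmx U = 1%:M.

Definition vnorm {R : realType} {n : nat} (v : 'cV[R[i]]_n) : R :=
  Num.sqrt (\sum_(i < n) cmod (v i ord0) ^+ 2).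

Definition mxnorm2 {R : realType} {m n : nat} (A : 'M[R[i]]_(m, n)) : R :=
  sup [set vnorm (A *m v) | v in [set v : 'cV[R[i]]_n | vnorm v = 1]].

Definition singular_value {R : realType} {n : nat} (A : 'M[R[i]]_n) (s : R) :
  Prop := 0 <= s /\ eigenvalue (adjmx A *m A) (s ^+ 2)%:C.

(* The set of singular values is finite, so for n > 0 the infimum is attained.
   A 0 x 0 matrix has no singular value and gets the value inf set0 = 0. *)
Definition sigma_min {R : realType} {n : nat} (A : 'M[R[i]]_n) : R :=
  inf [set s : R | singular_value A s].

Definition angle {R : realType} {n : nat} (x y : 'cV[R[i]]_n) : R :=
  acos (cmod ((adjmx x *m y) ord0 ord0) / (vnorm x * vnorm y)).

(* Sine of the angle between the unit vector x and the column space of W,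
   for W with orthonormal columns. *)
Definition sin_angle_space {R : realType} {n m : nat} (x : 'cV[R[i]]_n)
  (W : 'M[R[i]]_(n, m)) : R := vnorm ((1%:M - W *m adjmx W) *m x).

Definition analytic_at {R : realType} (f : R[i] -> R[i]) (a : R[i]) : Prop :=
  exists2 r : R, 0 < r & exists c : nat -> R[i],
    forall l : R[i], cmod (l - a) < r ->
      series (fun k => c k * (l - a) ^+ k : R[i]^o) @ \oo --> (f l : R[i]^o).

Definition analytic_on {R : realType} {n : nat} (Omega : set R[i])
    (T : R[i] -> 'M[R[i]]_n) : Prop :=
  forall a, Omega a -> forall i j, analytic_at (fun l => T l i j) a.

Definition cderiv {R : realType} (f : R[i] -> R[i]) (l : R[i]) : R[i] :=
  derive1 (f : R[i]^o -> R[i]^o) l.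

Definition mxderiv {R : realType} {n : nat} (T : R[i] -> 'M[R[i]]_n)
    (l : R[i]) : 'M[R[i]]_n :=
  \matrix_(i, j) cderiv (fun l' => T l' i j) l.

Definition simple_eigenvalue {R : realType} {n : nat}
    (T : R[i] -> 'M[R[i]]_n) (l : R[i]) : Prop :=
  \det (T l) = 0 /\ cderiv (fun l' => \det (T l')) l <> 0.

Definition eigenpair {R : realType} {n : nat} (Omega : set R[i])
    (T : R[i] -> 'M[R[i]]_n) (l : R[i]) (x : 'cV[R[i]]_n) : Prop :=
  [/\ Omega l, T l *m x = 0 & vnorm x = 1].

Definition compression {R : realType} {n m : nat} (W : 'M[R[i]]_(n, m))
    (T : R[i] -> 'M[R[i]]_n) (l : R[i]) : 'M[R[i]]_m :=
  adjmx W *m T l *m W.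

(* Main.v *)
Require Import Defs.
From HB Require Import structures.
From mathcomp Require Import all_boot all_order all_algebra perm.
From mathcomp Require Import all_classical all_reals all_analysis.
From mathcomp Require Import complex ring lra.

(** Write [u = W^H xs = a z + Zp w]. By Pythagoras [sin^2 = eps^2 + |w|^2], and
    [C(lam) w] splits into [Zp^H B(lam) u], which only sees the component of [xs]
    orthogonal to [W], and [a Zp^H (B(lam) - B(mu)) z], which is controlled by the
    first-order Taylor expansion of [T] at [lam]; then [sigma_min C * |w| <= |C w|].
    For uniqueness, a second kernel vector of [B(mu)] makes the first column of
    [B(mu + h) (z Zp)] of size O(h) and all its cofactors o(1), so that the
    derivative of [det B] would vanish at [mu]. *)

Set Implicit Arguments.
Unset Strict Implicit.
Unset Printing Implicit Defensive.

Import Order.TTheory GRing.Theory Num.Theory.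
Import numFieldNormedType.Exports.

Local Open Scope classical_set_scope.
Local Open Scope complex_scope.
Local Open Scope ring_scope.

(** * The real-valued modulus on [R[i]] *)

Section Modulus.
Variable R : realType.
Implicit Types x y : R[i].

Lemma norm_cmod x : `|x| = (cmod x)%:C.
Proof. by rewrite normc_def; case: x. Qed.

Lemma cmod_ge0 x : 0 <= cmod x.
Proof. by case: x => a b; exact: sqrtr_ge0. Qed.

Lemma cmodM x y : cmod (x * y) = cmod x * cmod y.
Proof. exact: ComplexField.Normc.normcM. Qed.

Lemma cmodD x y : cmod (x + y) <= cmod x + cmod y.
Proof. by rewrite -lecR rmorphD /= -!norm_cmod ler_normD. Qed.

Lemma cmodN x : cmod (- x) = cmod x.
Proof. by apply: complexI; rewrite -!norm_cmod normrN. Qed.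

Lemma cmodX x n : cmod (x ^+ n) = cmod x ^+ n.
Proof. by apply: complexI; rewrite rmorphXn /= -!norm_cmod normrX. Qed.

Lemma cmod_sum (I : Type) (r : seq I) (P : pred I) (F : I -> R[i]) :
  cmod (\sum_(i <- r | P i) F i) <= \sum_(i <- r | P i) cmod (F i).
Proof.
apply: (big_rec2 (fun (x : R[i]) (y : R) => cmod x <= y)).
- by rewrite ComplexField.Normc.normc0.
- by move=> i x y _ h; rewrite (le_trans (cmodD _ _))// lerD2l.
Qed.

Lemma cmod_sqr x : (cmod x ^+ 2)%:C = Num.conj x * x.
Proof. by rewrite rmorphXn /= -norm_cmod normCK mulrC. Qed.

Lemma cmod_real (a : R) : cmod (a%:C) = `|a|.
Proof. by apply: complexI; rewrite -norm_cmod normc_def /= expr0n addr0 sqrtr_sqr. Qed.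

End Modulus.

(** * Euclidean norm, spectral norm, adjoints and isometries *)

Section EuclideanNorm.
Variable R : realType.

(** Cauchy-Schwarz: with [A], [B] the two norms, expanding the sum of [(A b_i - B a_i)^2 >= 0]
    leaves a factor [A * B] to cancel, so vanishing norms are treated first. *)
Lemma sum_mul_le_sqrt (I : finType) (a b : I -> R) :
  \sum_i a i * b i <= Num.sqrt (\sum_i a i ^+ 2) * Num.sqrt (\sum_i b i ^+ 2).
Proof.
have sq0 (c : I -> R) : 0 <= \sum_i c i ^+ 2 by apply: sumr_ge0 => i _; exact: sqr_ge0.
have z0 (c : I -> R) : Num.sqrt (\sum_i c i ^+ 2) = 0 -> forall i, c i = 0.
  move=> /eqP; rewrite sqrtr_eq0 => c0 i.
  have /eqP : \sum_i c i ^+ 2 = 0 by apply/eqP; rewrite eq_le c0 sq0.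
  rewrite psumr_eq0; last by move=> j _; exact: sqr_ge0.
  by move=> /allP /(_ i); rewrite mem_index_enum sqrf_eq0 => /(_ isT)/eqP.
set A := Num.sqrt _; set B := Num.sqrt _.
have A2 : A ^+ 2 = \sum_i a i ^+ 2 by rewrite sqr_sqrtr.
have B2 : B ^+ 2 = \sum_i b i ^+ 2 by rewrite sqr_sqrtr.
have [/z0 a0|An0] := eqVneq A 0.
  by rewrite big1 ?mulr_ge0 ?sqrtr_ge0// => i _; rewrite a0 mul0r.
have [/z0 b0|Bn0] := eqVneq B 0.
  by rewrite big1 ?mulr_ge0 ?sqrtr_ge0// => i _; rewrite b0 mulr0.
have AB0 : 0 < A * B by rewrite mulr_gt0 // lt0r ?An0 ?Bn0 sqrtr_ge0.
rewrite -(ler_pM2l AB0).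
have := sq0 (fun i => A * b i - B * a i).
have -> : \sum_i (A * b i - B * a i) ^+ 2 =
    A ^+ 2 * (\sum_i b i ^+ 2) + B ^+ 2 * (\sum_i a i ^+ 2)
    - 2 * (A * B) * \sum_i a i * b i.
  by rewrite !mulr_sumr -big_split -sumrB; apply: eq_bigr => i _ /=; ring.
by rewrite -A2 -B2; lra.
Qed.

Lemma vnorm_ge0 n (v : 'cV[R[i]]_n) : 0 <= vnorm v.
Proof. exact: sqrtr_ge0. Qed.

Lemma vnorm_sqr n (v : 'cV[R[i]]_n) :
  vnorm v ^+ 2 = \sum_i cmod (v i ord0) ^+ 2.
Proof. by rewrite sqr_sqrtr// sumr_ge0// => i _; exact: sqr_ge0. Qed.

Lemma cmod_le_vnorm n (v : 'cV[R[i]]_n) i : cmod (v i ord0) <= vnorm v.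
Proof.
rewrite -(@ler_pXn2r _ 2)// ?nnegrE ?vnorm_ge0 ?cmod_ge0// vnorm_sqr.
by rewrite (bigD1 i)//= lerDl sumr_ge0// => j _; exact: sqr_ge0.
Qed.

Lemma vnorm0 n : vnorm (0 : 'cV[R[i]]_n) = 0.
Proof.
by rewrite /vnorm big1 ?sqrtr0// => i _; rewrite mxE ComplexField.Normc.normc0 expr0n.
Qed.

Lemma vnorm_eq0 n (v : 'cV[R[i]]_n) : vnorm v = 0 -> v = 0.
Proof.
move=> v0; have /eqP := vnorm_sqr v; rewrite v0 expr0n eq_sym psumr_eq0.
  move=> /allP h; apply/colP => i; have := h i; rewrite mem_index_enum mxE.
  by rewrite sqrf_eq0 => /(_ isT)/eqP/ComplexField.Normc.eq0_normc.
by move=> i _; exact: sqr_ge0.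
Qed.

Lemma vnormZ n (a : R[i]) (v : 'cV[R[i]]_n) : vnorm (a *: v) = cmod a * vnorm v.
Proof.
apply/eqP; rewrite -(@eqrXn2 _ 2)// ?mulr_ge0 ?vnorm_ge0 ?cmod_ge0//.
rewrite exprMn !vnorm_sqr mulr_sumr; apply/eqP/eq_bigr => i _.
by rewrite mxE cmodM exprMn.
Qed.

Lemma vnormN n (v : 'cV[R[i]]_n) : vnorm (- v) = vnorm v.
Proof. by rewrite /vnorm; under eq_bigr do rewrite mxE cmodN. Qed.

Lemma vnormD n (u v : 'cV[R[i]]_n) : vnorm (u + v) <= vnorm u + vnorm v.
Proof.
rewrite -(@ler_pXn2r _ 2)// ?nnegrE ?addr_ge0 ?vnorm_ge0//.
have := sum_mul_le_sqrt (fun i => cmod (u i ord0)) (fun i => cmod (v i ord0)).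
rewrite -/(vnorm u) -/(vnorm v) => cs.
rewrite sqrrD !vnorm_sqr -mulr_natl.
apply: (@le_trans _ _ (\sum_i (cmod (u i ord0) + cmod (v i ord0)) ^+ 2)).
  apply: ler_sum => i _; rewrite mxE ler_pXn2r// ?nnegrE ?addr_ge0 ?cmod_ge0//.
  exact: cmodD.
rewrite (_ : \sum_i _ = \sum_i cmod (u i ord0) ^+ 2
    + 2 * (\sum_i cmod (u i ord0) * cmod (v i ord0))
    + \sum_i cmod (v i ord0) ^+ 2); last first.
  by rewrite mulr_sumr -!big_split /=; apply: eq_bigr => i _; ring.
by rewrite lerD2r lerD2l ler_pM2l.
Qed.

(** Frobenius bound, from Cauchy-Schwarz on each row. It makes the supremum in [mxnorm2] finite and
    later turns entrywise estimates into vector estimates. *)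
Lemma vnorm_mul_le m n (A : 'M[R[i]]_(m, n)) (v : 'cV_n) :
  vnorm (A *m v) <= Num.sqrt (\sum_i \sum_j cmod (A i j) ^+ 2) * vnorm v.
Proof.
pose F i := \sum_j cmod (A i j) ^+ 2.
have F0 i : 0 <= F i by apply: sumr_ge0 => j _; exact: sqr_ge0.
rewrite -(@ler_pXn2r _ 2)// ?nnegrE ?mulr_ge0 ?vnorm_ge0 ?sqrtr_ge0//.
rewrite exprMn (vnorm_sqr (_ *m _)) (@sqr_sqrtr _ (\sum_i F i)) ?sumr_ge0// mulr_suml.
apply: ler_sum => i _; rewrite mxE -[F i]sqr_sqrtr// -exprMn.
rewrite ler_pXn2r// ?nnegrE ?mulr_ge0 ?cmod_ge0 ?vnorm_ge0 ?sqrtr_ge0//.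
apply: (le_trans (cmod_sum _ _ _)).
under eq_bigr do rewrite cmodM.
exact: (sum_mul_le_sqrt (fun j => cmod (A i j)) (fun j => cmod (v j ord0))).
Qed.

Lemma le_mxnorm2 m n (A : 'M[R[i]]_(m, n)) (v : 'cV_n) :
  vnorm (A *m v) <= mxnorm2 A * vnorm v.
Proof.
have [v0|v0] := eqVneq (vnorm v) 0.
  by rewrite (vnorm_eq0 v0) mulmx0 !vnorm0 mulr0.
have vp : 0 < vnorm v by rewrite lt0r v0 vnorm_ge0.
pose u := (vnorm v)^-1%:C *: v.
have u1 : vnorm u = 1.
  by rewrite vnormZ cmod_real ger0_norm ?invr_ge0 ?vnorm_ge0// mulVf.
have -> : A *m v = (vnorm v)%:C *: (A *m u).
  rewrite -scalemxAr scalerA -rmorphM /= divff//.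
  by rewrite scale1r.
rewrite vnormZ cmod_real ger0_norm ?vnorm_ge0// mulrC ler_pM2r//.
apply: ub_le_sup; last by exists u.
exists (Num.sqrt (\sum_i \sum_j cmod (A i j) ^+ 2)) => _ [w /= w1 <-].
by rewrite -[leRHS]mulr1 -w1; exact: vnorm_mul_le.
Qed.

Lemma mxnorm2_ge0 m n (A : 'M[R[i]]_(m, n)) : 0 <= mxnorm2 A.
Proof.
have [[v v1]|nv] := pselect (exists v : 'cV[R[i]]_n, vnorm v = 1).
  by have := le_mxnorm2 A v; rewrite v1 mulr1; apply: le_trans; exact: vnorm_ge0.
(* Without unit vectors the supremum ranges over the empty set and has the default value 0. *)
rewrite /mxnorm2 (_ : [set v | _] = set0) ?image_set0 ?sup0//.
by apply/seteqP; split=> // v v1; apply: nv; exists v.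
Qed.

Lemma adjmxM m n p (A : 'M[R[i]]_(m, n)) (B : 'M[R[i]]_(n, p)) :
  adjmx (A *m B) = adjmx B *m adjmx A.
Proof. by rewrite /adjmx trmx_mul map_mxM. Qed.

Lemma adjmxK m n (A : 'M[R[i]]_(m, n)) : adjmx (adjmx A) = A.
Proof. by apply/matrixP => i j; rewrite !mxE conjCK. Qed.

Lemma adjmxB m n (A B : 'M[R[i]]_(m, n)) : adjmx (A - B) = adjmx A - adjmx B.
Proof. by apply/matrixP => i j; rewrite !mxE rmorphB. Qed.

Lemma adjmx1 n : adjmx (1%:M : 'M[R[i]]_n) = 1%:M.
Proof. by apply/matrixP => i j; rewrite !mxE eq_sym rmorph_nat. Qed.

Lemma vnorm_sqr_adj n (v : 'cV[R[i]]_n) :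
  (vnorm v ^+ 2)%:C = (adjmx v *m v) ord0 ord0.
Proof.
rewrite vnorm_sqr mxE rmorph_sum; apply: eq_bigr => i _ /=.
by rewrite cmod_sqr !mxE.
Qed.

Lemma vnorm_isometry m n (W : 'M[R[i]]_(n, m)) (v : 'cV_m) :
  adjmx W *m W = 1%:M -> vnorm (W *m v) = vnorm v.
Proof.
move=> W1; apply/eqP; rewrite -(@eqrXn2 _ 2)// ?vnorm_ge0//; apply/eqP.
by apply: complexI; rewrite !vnorm_sqr_adj adjmxM mulmxA -[_ *m adjmx W *m W]mulmxA W1 mulmx1.
Qed.

(** Pythagoras for the projector [I - W W^H]: being self-adjoint and idempotent, it contributes
    [x^H (x - W W^H x)]. *)
Lemma vnorm_coisometry m n (W : 'M[R[i]]_(n, m)) (x : 'cV_n) :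
  adjmx W *m W = 1%:M ->
  vnorm x ^+ 2 = vnorm (adjmx W *m x) ^+ 2
    + vnorm ((1%:M - W *m adjmx W) *m x) ^+ 2.
Proof.
move=> W1; apply: complexI; rewrite rmorphD /= !vnorm_sqr_adj.
rewrite !adjmxM adjmxK adjmxB adjmx1 adjmxM adjmxK.
rewrite -!mulmxA.
have -> : (1%:M - W *m adjmx W) *m ((1%:M - W *m adjmx W) *m x) =
  x - W *m (adjmx W *m x).
  rewrite !mulmxBl !mul1mx !mulmxBr -!mulmxA.
  by rewrite [adjmx W *m (W *m _)]mulmxA W1 mul1mx subrr subr0.
rewrite mulmxBr; set q := adjmx x *m (W *m _).
by rewrite [(_ - q) _ _]mxE [(- q) _ _]mxE [RHS]addrC subrK.
Qed.

Lemma vnorm_adj_le m n (W : 'M[R[i]]_(n, m)) (x : 'cV_n) :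
  adjmx W *m W = 1%:M -> vnorm (adjmx W *m x) <= vnorm x.
Proof.
move=> /vnorm_coisometry h; rewrite -(@ler_pXn2r _ 2)// ?nnegrE ?vnorm_ge0//.
by rewrite (h x) lerDl sqr_ge0.
Qed.

End EuclideanNorm.

(** * The smallest singular value as a lower bound for [|A v| / |v|] *)

Section SmallestSingularValue.
Variable R : realType.

(** The spectral theorem diagonalises the Hermitian matrix [A^H A] by a unitary [P]; the squares of
    the [s i] are its diagonal entries. *)
Lemma singular_value_decomposition n (A : 'M[R[i]]_n) :
  exists (P : 'M[R[i]]_n) (s : 'I_n -> R),
    [/\ adjmx P *m P = 1%:M, forall i, singular_value A (s i) &
        forall v : 'cV_n, vnorm (A *m v) ^+ 2 =
          \sum_i s i ^+ 2 * cmod ((P *m v) i ord0) ^+ 2].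
Proof.
pose H := adjmx A *m A.
have Hherm : H \is hermsymmx.
  by apply/is_hermitianmxP; rewrite expr0 scale1r -[RHS]/(adjmx H) adjmxM adjmxK.
pose P := spectralmx H; pose d := spectral_diag H.
have PU : P \is unitarymx := spectral_unitarymx H.
have invP : invmx P = adjmx P by exact: (@invmx_unitary R[i] n P PU).
have Punit : P \in unitmx := unitarymx_unit PU.
have PP : adjmx P *m P = 1%:M by rewrite -invP mulVmx.
have PP' : P *m adjmx P = 1%:M by rewrite -invP mulmxV.
have HE : H = adjmx P *m diag_mx d *m P.
  by rewrite -invP; apply/orthomx_spectralP/hermitian_normalmx.
have AE (v : 'cV[R[i]]_n) : (vnorm (A *m v) ^+ 2)%:C =
    \sum_i d ord0 i * (cmod ((P *m v) i ord0) ^+ 2)%:C.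
  rewrite vnorm_sqr_adj adjmxM -mulmxA [adjmx A *m _]mulmxA -/H HE.
  rewrite -!mulmxA mulmxA -adjmxM mxE; apply: eq_bigr => i _.
  by rewrite mul_diag_mx !mxE cmod_sqr mulrCA.
(* Defined as the norm of [A] on the i-th eigenvector, [s i] is real and nonnegative from the start;
   [AE] then shows that its square is the complex number [d ord0 i]. *)
pose s i := vnorm (A *m (adjmx P *m delta_mx i (ord0 : 'I_1))).
have sE i : (s i ^+ 2)%:C = d ord0 i.
  rewrite AE mulmxA PP' mul1mx (bigD1 i)//= big1 => [|j ji].
    by rewrite !mxE !eqxx ComplexField.Normc.normc1 expr1n mulr1 addr0.
  by rewrite !mxE (negbTE ji) ComplexField.Normc.normc0 expr0n mulr0.
exists P, s; split=> // [i|v].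
  split; first exact: vnorm_ge0.
  (* [eigenvalue] refers to row eigenvectors, hence a row of [P]; it is nonzero because
     [P P^H = 1]. *)
  apply/eigenvalueP; exists (row i P).
    rewrite sE -/H HE -row_mul !mulmxA PP' mul1mx.
    by apply/rowP => j; rewrite mxE mul_diag_mx !mxE.
  apply/negP => /eqP r0; have : row i (P *m adjmx P) = 0 by rewrite row_mul r0 mul0mx.
  rewrite PP' => /rowP/(_ i); rewrite !mxE eqxx => /eqP.
  by rewrite oner_eq0.
apply: complexI; rewrite AE rmorph_sum; apply: eq_bigr => i _ /=.
by rewrite -sE -rmorphM.
Qed.

(** In the coordinates [P v], which have the norm of [v], each weight [s i] is a singular value and
    so dominates the infimum. *)
Lemma sigma_min_le n (A : 'M[R[i]]_n) (v : 'cV_n) : 0 < sigma_min A ->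
  sigma_min A * vnorm v <= vnorm (A *m v).
Proof.
move=> A0; have [P [s [PP sv AE]]] := singular_value_decomposition A.
rewrite -(@ler_pXn2r _ 2)// ?nnegrE ?mulr_ge0 ?vnorm_ge0 ?(ltW A0)//.
rewrite exprMn AE -(vnorm_isometry v PP) vnorm_sqr mulr_sumr.
apply: ler_sum => i _; apply: ler_wpM2r; first exact: sqr_ge0.
have [si0 _] := sv i.
rewrite ler_pXn2r// ?nnegrE ?(ltW A0)//.
by apply: ge_inf; [exists 0 => t []|exact: sv].
Qed.

End SmallestSingularValue.

(** * The unitary matrix [(z Zp)] and the sine of an angle *)

Section UnitaryColumns.
Variable R : realType.

Lemma unitary_row_mx m k (z : 'cV[R[i]]_m) (Z : 'M[R[i]]_(m, k)) :
  unitary (row_mx z Z) ->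
  [/\ adjmx z *m z = 1%:M, adjmx Z *m z = 0, adjmx Z *m Z = 1%:M &
      z *m adjmx z + Z *m adjmx Z = 1%:M].
Proof.
rewrite /unitary; have -> : adjmx (row_mx z Z) = col_mx (adjmx z) (adjmx Z).
  by rewrite /adjmx tr_row_mx map_col_mx.
case; rewrite mul_col_row mul_row_col => + zZ.
by rewrite scalar_mx_block => /eq_block_mx [].
Qed.

Lemma vnorm_unitary_row_mx m k (z : 'cV[R[i]]_m) (Z : 'M[R[i]]_(m, k)) (u : 'cV_m) :
  unitary (row_mx z Z) ->
  vnorm u ^+ 2 = cmod ((adjmx z *m u) ord0 ord0) ^+ 2 + vnorm (adjmx Z *m u) ^+ 2.
Proof.
case/unitary_row_mx => _ _ _ zZ; apply: complexI.
rewrite rmorphD /= !vnorm_sqr_adj cmod_sqr -{2}[u]mul1mx -zZ mulmxDl mulmxDr mxE.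
rewrite !adjmxM !adjmxK !mulmxA; congr (_ + _).
rewrite -mulmxA mxE big_ord1; congr (_ * _).
by rewrite -{1}[z]adjmxK -adjmxM !mxE.
Qed.

Lemma sin_angle_unit n (x y : 'cV[R[i]]_n) : vnorm x = 1 ->
  vnorm y = 1 -> cmod ((adjmx x *m y) ord0 ord0) <= 1 ->
  sin (angle x y) = Num.sqrt (1 - cmod ((adjmx x *m y) ord0 ord0) ^+ 2).
Proof.
move=> x1 y1 le1; rewrite /angle x1 y1 mulr1 divr1 sin_acos//.
by rewrite le1 andbT (le_trans _ (cmod_ge0 _))// lerN10.
Qed.

End UnitaryColumns.

(** * Complex limits, derivatives and expansions of analytic functions *)

Lemma cvg_detmx (K : numFieldType) (X : Type) (F : set_system X) k
    (M : X -> 'M[K]_k) (M0 : 'M[K]_k) : Filter F ->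
  (forall i j, (fun x => M x i j) @ F --> M0 i j) ->
  (fun x => \det (M x)) @ F --> \det M0.
Proof.
move=> FF MM0; rewrite /determinant.
apply: (cvg_big (op := +%R)) => [|s _]; first exact: add_continuous.
apply: cvgM; first exact: cvg_cst.
have := @cvg_big K _ *%R 1 xpredT (@mul_continuous K) X F (index_enum _) (fun i x => M x i (s i)) (fun i => M0 i (s i)) FF.
by apply => i _; exact: MM0.
Qed.

Section ComplexLimits.
Variable R : realType.
Implicit Types (f : R[i] -> R[i]) (a : R[i]).

(** The norm of [R[i]^o] takes values in [R[i]]. A positive element there is real and equals its own
    modulus, so tolerances translate both ways. *)
Lemma cvg_cmod_lt (X : Type) (F : set_system X) {FF : Filter F} (u : X -> R[i]) (l : R[i]) :
  (u : X -> R[i]^o) @ F --> (l : R[i]^o) <->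
  forall e : R, 0 < e -> \forall x \near F, cmod (u x - l) < e.
Proof.
split=> [ul e e0|H].
  have /(_ e%:C) := (@cvgrPdistC_lt _ R[i]^o _ F FF _ _).1 ul; rewrite ltcR => /(_ e0).
  by apply: filterS => x; rewrite [`|_|]norm_cmod ltcR.
apply/cvgrPdistC_lt => e e0.
have eE : e = (cmod e)%:C by rewrite -norm_cmod gtr0_norm.
have /H : 0 < cmod e by rewrite -ltcR -eE.
by apply: filterS => x; rewrite [`|_|]norm_cmod eE ltcR -eE.
Qed.

Lemma nbhs_cmodP (P : R[i] -> Prop) a :
  (\forall x \near (a : R[i]^o), P x) <->
  exists2 r : R, 0 < r & forall h, cmod h < r -> P (a + h).
Proof.
split=> [/nbhs_normP [r /= r0 H]|[r r0 H]].
  have rE : r = (cmod r)%:C by rewrite -norm_cmod gtr0_norm.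
  exists (cmod r); first by rewrite -ltcR -rE.
  move=> h hr; apply: H => /=; rewrite opprD addrA subrr sub0r normrN.
  by rewrite [`|_|]norm_cmod rE ltcR.
apply/nbhs_normP; exists r%:C => /=; first by rewrite ltcR.
move=> x /= ; rewrite [`|_|]norm_cmod ltcR => xr.
rewrite -[x](subrKC a); apply: H.
by rewrite -cmodN opprB.
Qed.

Lemma cderiv_eq f a d :
  (forall e : R, 0 < e -> exists2 r : R, 0 < r &
     forall h, cmod h < r -> cmod (f (a + h) - f a - d * h) <= e * cmod h) ->
  cderiv f a = d.
Proof.
move=> H; rewrite /cderiv /derive1; apply: (@cvg_lim R[i]^o) => //.
apply/cvg_cmod_lt => e e0.
(* Half the tolerance turns the weak inequality of [H] into a strict one. *)
have [r r0 Hr] := H _ (divr_gt0 e0 (ltr0n _ 2)).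
apply/nbhs_cmodP; exists r => // h hr h0.
rewrite add0r in h0 *.
have hp : 0 < cmod h.
  by rewrite lt0r cmod_ge0 andbT; apply: contra h0 => /eqP/ComplexField.Normc.eq0_normc ->.
have -> : h^-1 *: (f (h + a) - f a : R[i]^o) - d =
    h^-1 * (f (a + h) - f a - d * h).
  by rewrite [h + a]addrC mulrBr [d * h]mulrC mulrA mulVf// mul1r.
rewrite cmodM ComplexField.Normc.normcV mulrC ltr_pdivrMr//.
by apply: (le_lt_trans (Hr h hr)); rewrite ltr_pM2r// ltr_pdivrMr// ltr_pMr// ltr1n.
Qed.

Lemma geometric_half_le (t : R) p : 0 <= t <= 2^-1 ->
  \sum_(k < p) t ^+ k <= 2.
Proof.
move=> /andP[t0 t2].
(* This is the exact partial sum at ratio 1/2, a bound strong enough for the induction. *)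
apply: (@le_trans _ _ (2 - (2^-1) ^+ p * 2)); last first.
  by rewrite gerBl mulr_ge0// exprn_ge0// invr_ge0.
elim: p => [|p ih]; first by rewrite big_ord0 expr0 mul1r subrr.
rewrite big_ord_recr /= exprS.
have : t ^+ p <= (2^-1) ^+ p by rewrite lerXn2r// nnegrE invr_ge0.
by move: ih; lra.
Qed.

(** From some [N] on, partial sums lie within 1 of the limit, so a term, as a difference of two of
    them, has modulus at most 2. The earlier terms are bounded by their sum. *)
Lemma powser_term_bounded (c : nat -> R[i]) (h l : R[i]) :
  series (fun k => c k * h ^+ k : R[i]^o) @ \oo --> (l : R[i]^o) ->
  exists2 M : R, 0 <= M & forall k, cmod (c k * h ^+ k) <= M.
Proof.
move=> /cvg_cmod_lt /(_ 1 ltr01) [N _ HN].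
pose F k := cmod (c k * h ^+ k).
have F0 k : 0 <= F k := cmod_ge0 _.
exists (\sum_(k < N) F k + 2) => [|k]; first by rewrite addr_ge0// sumr_ge0.
have [kN|Nk] := ltnP k N.
  rewrite (bigD1 (Ordinal kN))//= -addrA lerDl addr_ge0// sumr_ge0// => i _.
rewrite ler_wpDl ?sumr_ge0//.
have h1 : cmod (series (fun k => c k * h ^+ k : R[i]^o) k - l) < 1 by exact: HN.
have h2 : cmod (series (fun k => c k * h ^+ k : R[i]^o) k.+1 - l) < 1.
  by apply: HN => /=; exact: leqW.
have -> : c k * h ^+ k = (series (fun k => c k * h ^+ k : R[i]^o) k.+1 - l)
     + - (series (fun k => c k * h ^+ k : R[i]^o) k - l).
  by rewrite /series /= big_nat_recr//= ; ring.
by apply: (le_trans (cmodD _ _)); rewrite cmodN; move: h1 h2; lra.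
Qed.

(** At half the radius of convergence, [rho], all terms are bounded by some [M]. For [|h| < rho / 2]
    and [t = |h| / rho], the terms from index 2 on are dominated by a geometric series of sum at
    most [2 M t^2]. *)
Lemma analytic_expansion f a : analytic_at f a ->
  exists d, exists K r : R, [/\ 0 < r, 0 <= K &
    forall h, cmod h < r -> cmod (f (a + h) - f a - d * h) <= K * cmod h ^+ 2].
Proof.
move=> [r r0 [c Hc]].
pose rho := r / 2.
have rho0 : 0 < rho by rewrite divr_gt0.
have cvh h : cmod h < r ->
    series (fun k => c k * h ^+ k : R[i]^o) @ \oo --> (f (a + h) : R[i]^o).
  by move=> hr; have := Hc (a + h); rewrite [a + h]addrC addrK; exact.
have crho : cmod (rho%:C) = rho by rewrite cmod_real gtr0_norm.
have [|M M0 HM] := @powser_term_bounded c rho%:C (f (a + rho%:C)).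
  by apply: cvh; rewrite crho /rho; move: r0; lra.
have bound h : cmod h < rho / 2 ->
    cmod (f (a + h) - c 0%N - c 1%N * h) <= 2 * M / rho ^+ 2 * cmod h ^+ 2.
  move=> hr; pose t := cmod h / rho.
  have t0 : 0 <= t by rewrite divr_ge0 ?cmod_ge0 ?ltW.
  have t2 : t <= 2^-1 by rewrite ler_pdivrMr// mulrC ltW.
  have hE : cmod h = t * rho by rewrite divfK// gt_eqF.
  have term k : cmod (c k * h ^+ k) <= M * t ^+ k.
    rewrite cmodM cmodX hE exprMn mulrCA mulrC ler_wpM2r ?exprn_ge0//.
    by have := HM k; rewrite cmodM cmodX crho.
  have tail p : cmod (\sum_(k < p) c k.+2 * h ^+ k.+2) <= 2 * M * t ^+ 2.
    apply: (le_trans (cmod_sum _ _ _)).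
    apply: (@le_trans _ _ (\sum_(k < p) M * t ^+ 2 * t ^+ k)).
      by apply: ler_sum => k _; rewrite -mulrA -exprD; exact: term.
    rewrite -mulr_sumr (_ : 2 * M * t ^+ 2 = M * t ^+ 2 * 2); last by ring.
    apply: ler_wpM2l; first by rewrite mulr_ge0 ?sqr_ge0.
    by apply: geometric_half_le; rewrite t0.
  have -> : 2 * M / rho ^+ 2 * cmod h ^+ 2 = 2 * M * t ^+ 2.
    by rewrite hE; field; rewrite gt_eqF.
  (* The bound on finite tails passes to the limit: a partial sum with [N + 2] terms is within [e]
     of [f (a + h)], and its first two terms are split off. *)
  apply/ler_addgt0Pr => e e0.
  have /cvg_cmod_lt /(_ e e0) [N _ HN] : series (fun k => c k * h ^+ k : R[i]^o) @ \oo
      --> (f (a + h) : R[i]^o).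
    by apply: cvh; move: hr; rewrite /rho; move: r0; lra.
  have := HN N.+2; rewrite /= => /(_ (leqW (leqnSn N))).
  rewrite /series /= big_mkord !big_ord_recl /= /bump /= expr0 mulr1 expr1.
  under eq_bigr do rewrite !add1n.
  set S := \sum_(k < N) _ => He.
  have -> : f (a + h) - c 0%N - c 1%N * h =
     S + - (c 0%N + (c 1%N * h + S) - f (a + h)) by ring.
  apply: (le_trans (cmodD _ _)); rewrite cmodN lerD ?(ltW He)//.
  exact: tail.
(* The bound at [h = 0] forces the constant coefficient to be [f a]. *)
have fa : f a = c 0%N.
  have := bound 0; rewrite ComplexField.Normc.normc0 divr_gt0// => /(_ isT).
  rewrite expr0n !mulr0 addr0 subr0 => h0; apply/eqP; rewrite -subr_eq0; apply/eqP.
  by apply: ComplexField.Normc.eq0_normc; apply/eqP; rewrite eq_le h0 cmod_ge0.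
exists (c 1%N), (2 * M / rho ^+ 2), (rho / 2); split=> [||h hr].
- by rewrite divr_gt0.
- by apply: divr_ge0; [exact: mulr_ge0 | exact: sqr_ge0].
- by rewrite fa bound.
Qed.

Lemma cderiv_quadratic f a d (K r : R) : 0 < r -> 0 <= K ->
  (forall h, cmod h < r -> cmod (f (a + h) - f a - d * h) <= K * cmod h ^+ 2) ->
  cderiv f a = d.
Proof.
move=> r0 K0 H; apply: cderiv_eq => e e0.
(* Below this radius [K |h|^2 <= e |h|]; [K + 1] keeps the denominator positive when [K = 0]. *)
exists (Num.min r (e / (K + 1))).
  by rewrite lt_min r0 divr_gt0// ltr_wpDl.
move=> h; rewrite lt_min => /andP[hr he]; apply: (le_trans (H h hr)).
rewrite expr2 mulrA ler_wpM2r ?cmod_ge0//.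
move: he; rewrite ltr_pdivlMr ?ltr_wpDl// => he.
by have := cmod_ge0 h; nra.
Qed.

End ComplexLimits.

(** * The angle bound for fixed matrices, and Taylor estimates for [T] *)

Section RitzAngle.
Variable R : realType.

(** The pure linear algebra, to be used with [T0 = T lam] and [T1 = T mu]. Their difference enters
    only through the bound [b] on its action on the Ritz vector. *)
Lemma ritz_angle_bound n m (T0 T1 : 'M[R[i]]_n) (xs : 'cV[R[i]]_n)
    (W : 'M[R[i]]_(n, m)) (z : 'cV[R[i]]_m) k (Zp : 'M[R[i]]_(m, k)) (b : R) :
  let sigma := sigma_min (adjmx Zp *m (adjmx W *m T0 *m W) *m Zp) in
  let eps := sin_angle_space xs W in
  T0 *m xs = 0 -> vnorm xs = 1 -> adjmx W *m W = 1%:M ->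
  adjmx W *m T1 *m W *m z = 0 -> vnorm z = 1 -> unitary (row_mx z Zp) ->
  0 < sigma -> vnorm ((T1 - T0) *m (W *m z)) <= b ->
  sin (angle (W *m z) xs) <= eps + (mxnorm2 T0 * eps + b) / sigma.
Proof.
move=> sigma eps T0xs xs1 W1 T1z z1 Uz sigma0 hb.
pose u := adjmx W *m xs; pose w := adjmx Zp *m u; pose a := adjmx z *m u.
pose r := (1%:M - W *m adjmx W) *m xs.
have epsE : vnorm r = eps by [].
have eps0 : 0 <= eps by exact: vnorm_ge0.
have [_ _ Zp1 zZ] := unitary_row_mx Uz.
have aE : (adjmx (W *m z) *m xs) = a by rewrite adjmxM -mulmxA.
have pyth : 1 = cmod (a ord0 ord0) ^+ 2 + vnorm w ^+ 2 + eps ^+ 2.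
  by rewrite -(vnorm_unitary_row_mx u Uz) -epsE -(vnorm_coisometry xs W1) xs1 expr1n.
have a1 : cmod (a ord0 ord0) <= 1.
  rewrite -(@ler_pXn2r _ 2)// ?nnegrE ?cmod_ge0// expr1n pyth -addrA lerDl.
  by rewrite addr_ge0 ?sqr_ge0.
rewrite sin_angle_unit ?vnorm_isometry// aE//.
have -> : 1 - cmod (a ord0 ord0) ^+ 2 = vnorm w ^+ 2 + eps ^+ 2.
  by rewrite pyth; ring.
(* The root of a sum of squares is at most the sum, so it remains to bound [|w|]. *)
apply: (@le_trans _ _ (eps + vnorm w)).
  rewrite -(@ler_pXn2r _ 2)// ?nnegrE ?sqrtr_ge0 ?addr_ge0 ?vnorm_ge0//.
  rewrite sqr_sqrtr ?addr_ge0 ?sqr_ge0//.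
  have := mulr_ge0 eps0 (vnorm_ge0 w); lra.
rewrite lerD2l ler_pdivlMr// mulrC.
apply: (le_trans (sigma_min_le w sigma0)).
have Zw : Zp *m w = u - (a ord0 ord0) *: z.
  have aM : z *m a = a ord0 ord0 *: z.
    by apply/colP => i; rewrite [LHS]mxE big_ord1 [RHS]mxE mulrC.
  by rewrite -aM /w mulmxA -[u in RHS]mul1mx -zZ mulmxDl /a !mulmxA addrC addKr.
(* Since [xs = W u + r] and [T0 xs = 0], only the residual [r], of norm [eps], remains. *)
have T0Wu : T0 *m (W *m u) = - (T0 *m r).
  by rewrite /r mulmxBl mul1mx mulmxBr T0xs sub0r opprK /u !mulmxA.
(* The Galerkin condition [W^H T1 W z = 0] introduces the difference [T1 - T0]. *)
have T0Wz : adjmx W *m (T0 *m (W *m z)) = - (adjmx W *m ((T1 - T0) *m (W *m z))).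
  have T1z' : adjmx W *m (T1 *m (W *m z)) = 0 by rewrite !mulmxA.
  by rewrite mulmxBl mulmxBr T1z' sub0r opprK.
have -> : adjmx Zp *m (adjmx W *m T0 *m W) *m Zp *m w =
    adjmx Zp *m (adjmx W *m (- (T0 *m r)))
    + a ord0 ord0 *: (adjmx Zp *m (adjmx W *m ((T1 - T0) *m (W *m z)))).
  rewrite -!mulmxA Zw !mulmxBr T0Wu -!scalemxAr T0Wz.
  by rewrite [adjmx Zp *m - (adjmx W *m _)]mulmxN scalerN opprK.
apply: (le_trans (vnormD _ _)); apply: lerD.
  apply: (le_trans (vnorm_adj_le _ Zp1)); apply: (le_trans (vnorm_adj_le _ W1)).
  by rewrite vnormN -epsE; exact: le_mxnorm2.
rewrite vnormZ -[b]mul1r ler_pM ?cmod_ge0 ?vnorm_ge0//.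
apply: (le_trans (vnorm_adj_le _ Zp1)); apply: (le_trans (vnorm_adj_le _ W1)).
exact: hb.
Qed.

(** The expansions of the finitely many entries hold on a common disc, and the Frobenius norm of
    their constants serves as [K]. *)
Lemma analytic_mx_taylor n (T : R[i] -> 'M[R[i]]_n) lam :
  (forall i j, analytic_at (fun l => T l i j) lam) ->
  exists K r : R, [/\ 0 <= K, 0 < r & forall h, cmod h < r -> forall x : 'cV_n,
    vnorm ((T (lam + h) - T lam - h *: mxderiv T lam) *m x)
      <= K * cmod h ^+ 2 * vnorm x].
Proof.
move=> an.
have /choice[K HK] : forall ij : 'I_n * 'I_n, exists K : R, 0 <= K /\
    \forall l \near (lam : R[i]^o),
      cmod (T l ij.1 ij.2 - T lam ij.1 ij.2 - mxderiv T lam ij.1 ij.2 * (l - lam))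
        <= K * cmod (l - lam) ^+ 2.
  move=> [i j] /=; have [d [K [r [r0 K0 H]]]] := analytic_expansion (an i j).
  exists K; split=> //; apply/nbhs_cmodP; exists r => // h hr.
  by rewrite mxE (cderiv_quadratic r0 K0 H) [lam + h - lam]addrC addKr H.
have /nbhs_cmodP[r r0 Hr] := filter_forall (nbhs_filter (lam : R[i]^o)) (fun ij => (HK ij).2).
exists (Num.sqrt (\sum_i \sum_j K (i, j) ^+ 2)), r; split=> [||h hr x] //.
apply: (le_trans (vnorm_mul_le _ _)); apply: ler_wpM2r; first exact: vnorm_ge0.
rewrite -(@ler_pXn2r _ 2)// ?nnegrE ?mulr_ge0 ?sqrtr_ge0 ?sqr_ge0 ?cmod_ge0//.
have S0 (F : 'I_n * 'I_n -> R) : 0 <= \sum_i \sum_j F (i, j) ^+ 2.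
  by apply: sumr_ge0 => i _; apply: sumr_ge0 => j _; exact: sqr_ge0.
rewrite exprMn sqr_sqrtr; last first.
  exact: (S0 (fun ij => cmod ((T (lam + h) - T lam - h *: mxderiv T lam) ij.1 ij.2))).
rewrite sqr_sqrtr// mulr_suml; apply: ler_sum => i _.
rewrite mulr_suml; apply: ler_sum => j _; rewrite -exprMn.
rewrite ler_pXn2r// ?nnegrE ?mulr_ge0 ?cmod_ge0 ?sqr_ge0 ?(HK _).1//.
have := Hr h hr (i, j); rewrite /= [lam + h - lam]addrC addKr.
by rewrite !mxE [h * _]mulrC.
Qed.

Lemma analytic_mx_lipschitz n (T : R[i] -> 'M[R[i]]_n) lam :
  (forall i j, analytic_at (fun l => T l i j) lam) ->
  exists L r : R, [/\ 0 <= L, 0 < r & forall h, cmod h < r -> forall x : 'cV_n,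
    vnorm ((T (lam + h) - T lam) *m x) <= L * cmod h * vnorm x].
Proof.
move=> /analytic_mx_taylor [K [r [K0 r0 H]]].
(* Capping the radius at 1 absorbs [|h|^2] into [|h|]. *)
exists (K + mxnorm2 (mxderiv T lam)), (Num.min r 1); split.
- by rewrite addr_ge0 ?mxnorm2_ge0.
- by rewrite lt_min r0 ltr01.
move=> h; rewrite lt_min => /andP[hr h1] x.
rewrite -[T (lam + h) - T lam](subrK (h *: mxderiv T lam)) mulmxDl.
apply: (le_trans (vnormD _ _)); rewrite -mulrA mulrDl lerD//.
  apply: (le_trans (H h hr x)); rewrite -mulrA ler_wpM2l// ler_wpM2r ?vnorm_ge0//.
  by rewrite expr2 ler_piMr ?cmod_ge0// ltW.
rewrite -scalemxAl vnormZ mulrCA ler_wpM2l ?cmod_ge0//.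
exact: le_mxnorm2.
Qed.

End RitzAngle.

(** * One-dimensionality of the kernel at a simple eigenvalue *)

Section SimpleKernel.
Variable R : realType.

Lemma det_eq0_ker k (M : 'M[R[i]]_k) (w : 'cV_k) :
  w != 0 -> M *m w = 0 -> \det M = 0.
Proof.
move=> w0 Mw; rewrite -det_tr; apply/eqP/det0P; exists w^T.
  by rewrite trmx_eq0.
by rewrite -trmx_mul Mw trmx0.
Qed.

(* Expanding along the first column, each term is a product of an O(h) entry
   and a cofactor that tends to a vanishing minor of D 0. *)
Lemma det_littleo k (D : R[i] -> 'M[R[i]]_k.+1) (w : 'cV_k) (L r : R) :
  0 <= L -> 0 < r ->
  (forall h, cmod h < r -> forall i j, cmod (D h i j - D 0 i j) <= L * cmod h) ->
  (forall i, D 0 i ord0 = 0) ->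
  w != 0 -> (forall i, row' i (col' ord0 (D 0)) *m w = 0) ->
  forall e : R, 0 < e -> exists2 s : R, 0 < s &
    forall h, cmod h < s -> cmod (\det (D h)) <= e * cmod h.
Proof.
move=> L0 r0 HD D0 w0 Dw e e0.
pose minor i h := \det (row' i (col' ord0 (D h))).
(* Chosen so that [k + 1] cofactor terms of size [L |h| e'] add up to at most [e |h|], also when
   [L = 0]. *)
pose e' := e / (k.+1%:R * L + 1).
have kL : 0 <= k.+1%:R * L by rewrite mulr_ge0.
have e'0 : 0 < e' by rewrite divr_gt0// ltr_wpDl.
have cvD i j : (fun h => D h i j : R[i]^o) @ (0 : R[i]^o) --> (D 0 i j : R[i]^o).
  apply: (cvg_cmod_lt (FF := nbhs_filter (0 : R[i]^o)) _ _).2 => d d0.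
  apply/nbhs_cmodP; exists (Num.min r (d / (L + 1))).
    by rewrite lt_min r0 divr_gt0// ltr_wpDl.
  move=> h; rewrite lt_min add0r ltr_pdivlMr ?ltr_wpDl// => /andP[hr hd].
  by apply: le_lt_trans (HD h hr i j) _; have := cmod_ge0 h; lra.
have cvm i : \forall h \near (0 : R[i]^o), cmod (minor i h) < e'.
  have : (fun h => minor i h : R[i]^o) @ (0 : R[i]^o) --> (minor i 0 : R[i]^o).
    apply: (@cvg_detmx R[i] _ _ _ _ _ (nbhs_filter (0 : R[i]^o))) => a b.
    rewrite [X in _ --> X](_ : _ = D 0 (lift i a) (lift ord0 b)); last by rewrite !mxE.
    rewrite (_ : (fun _ => _) = (fun h => D h (lift i a) (lift ord0 b))).
      exact: cvD.
    by apply/funext => h; rewrite !mxE.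
  rewrite {2}/minor (det_eq0_ker w0 (Dw i)).
  move=> /(cvg_cmod_lt (FF := nbhs_filter (0 : R[i]^o)) _ _).1 /(_ e' e'0).
  by apply: filterS => h; rewrite subr0.
have /nbhs_cmodP[s s0 Hs] := filter_forall (nbhs_filter (0 : R[i]^o)) cvm.
exists (Num.min r s); first by rewrite lt_min r0.
move=> h; rewrite lt_min => /andP[hr hs].
rewrite (expand_det_col _ ord0); apply: (le_trans (cmod_sum _ _ _)).
apply: (@le_trans _ _ (\sum_(i < k.+1) L * cmod h * e')).
  apply: ler_sum => i _; rewrite cmodM ler_pM ?cmod_ge0//.
    by have := HD h hr i ord0; rewrite D0 subr0.
  rewrite /cofactor cmodM cmodX cmodN ComplexField.Normc.normc1 expr1n mul1r.
  by have := Hs h hs i; rewrite add0r => /ltW.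
rewrite sumr_const card_ord -mulr_natl.
have -> : k.+1%:R * (L * cmod h * e') = (k.+1%:R * L) * e' * cmod h by ring.
rewrite ler_wpM2r ?cmod_ge0// /e' mulrCA ler_piMr ?(ltW e0)//.
rewrite ler_pdivrMr ?ltr_wpDl//; lra.
Qed.

Lemma simple_eigenvalue_ker n m (T : R[i] -> 'M[R[i]]_n) (W : 'M[R[i]]_(n, m))
    (mu : R[i]) (z z' : 'cV[R[i]]_m) (Zp : 'M[R[i]]_(m, m.-1)) :
  (forall i j, analytic_at (fun l => T l i j) mu) ->
  adjmx W *m W = 1%:M -> vnorm z = 1 -> unitary (row_mx z Zp) ->
  simple_eigenvalue (compression W T) mu ->
  compression W T mu *m z = 0 -> compression W T mu *m z' = 0 ->
  z' = (adjmx z *m z') ord0 ord0 *: z.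
Proof.
move=> anT W1 z1 Uz [detB dB] Bz Bz'.
have [z1' _ Zp1 zZ] := unitary_row_mx Uz.
pose w := adjmx Zp *m z'.
have zE : z' = (adjmx z *m z') ord0 ord0 *: z + Zp *m w.
  rewrite -{1}[z']mul1mx -zZ mulmxDl -!mulmxA; congr (_ + _).
  by apply/colP => i; rewrite [LHS]mxE big_ord1 [RHS]mxE mulrC.
have [w0|wn0] := eqVneq w 0; first by rewrite {1}zE w0 mulmx0 addr0.
exfalso; apply: dB.
(* The split lets [m.-1] compute, so that [(z Zp)] becomes square. For [m = 0] the vector [w] has no
   entries and cannot be nonzero. *)
case: m W z z' Zp W1 z1 Uz detB Bz Bz' z1' Zp1 zZ w zE wn0 => [|m].
  by move=> ? ? ? ? ? _ _ _ _ _ _ _ _ w _; rewrite (flatmx0 w) eqxx.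
move=> W z z' Zp W1 z1 [Uz Uz'] detB Bz Bz' z1' Zp1 zZ w zE wn0.
pose U : 'M[R[i]]_m.+1 := row_mx z Zp.
have detU : \det U != 0.
  have : \det (adjmx U) * \det U = 1 by rewrite -det_mulmx Uz det1.
  by apply: contra_eqN => /eqP ->; rewrite mulr0 eq_sym oner_eq0.
have BZw : compression W T mu *m Zp *m w = 0.
  have : compression W T mu *m (Zp *m w) = 0.
    have := Bz'; rewrite zE mulmxDr -scalemxAr Bz scaler0 add0r; exact.
  by rewrite mulmxA.
pose D h := compression W T (mu + h) *m U.
have [L [r [L0 r0 HL]]] := analytic_mx_lipschitz anT.
have DE h i j : D h i j = (adjmx W *m (T (mu + h) *m (W *m col j U))) i ord0.
  by rewrite !mulmxA [LHS]mxE [RHS]mxE; apply: eq_bigr => a _; rewrite [col _ _ _ _]mxE.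
pose c := \sum_j vnorm (W *m col j U).
have HD h : cmod h < r -> forall i j, cmod (D h i j - D 0 i j) <= L * c * cmod h.
  move=> hr i j; rewrite !DE addr0.
  have -> : (adjmx W *m (T (mu + h) *m (W *m col j U))) i ord0 -
     (adjmx W *m (T mu *m (W *m col j U))) i ord0 =
     (adjmx W *m ((T (mu + h) - T mu) *m (W *m col j U))) i ord0.
    by rewrite mulmxBl mulmxBr [RHS]mxE [X in _ = _ + X]mxE.
  apply: (le_trans (cmod_le_vnorm _ _)); apply: (le_trans (vnorm_adj_le _ W1)).
  apply: (le_trans (HL h hr _)).
  rewrite mulrAC ler_wpM2r ?cmod_ge0// ler_wpM2l//.
  by rewrite /c (bigD1 j)//= lerDl sumr_ge0// => k _; exact: vnorm_ge0.
have c0 : 0 <= c by rewrite sumr_ge0// => k _; exact: vnorm_ge0.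
have DU : D 0 = row_mx (0 : 'M[R[i]]_(m.+1, 1)) (compression W T mu *m Zp).
  by rewrite /D addr0 /U (mul_mx_row (compression W T mu) z Zp) Bz.
have D00 i : D 0 i ord0 = 0.
  have e0 : ord0 = lshift m (ord0 : 'I_1) by exact/val_inj.
  by rewrite DU e0 (row_mxEl (0 : 'M[R[i]]_(m.+1, 1))) mxE.
have Dw i : row' i (col' ord0 (D 0)) *m w = 0.
  have -> : col' ord0 (D 0) = compression W T mu *m Zp.
    apply/matrixP => a b; rewrite mxE DU.
    have -> : lift ord0 b = rshift 1 b by exact/val_inj.
    by rewrite (row_mxEr (0 : 'M[R[i]]_(m.+1, 1))).
  apply/colP => a; rewrite [RHS]mxE.
  transitivity ((compression W T mu *m Zp *m w) (lift i a) ord0).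
    by rewrite [LHS]mxE [RHS]mxE; apply: eq_bigr => b _; rewrite [row' _ _ _ _]mxE.
  by rewrite BZw mxE.
apply: cderiv_eq => e e0.
have dU0 : 0 < cmod (\det U).
  rewrite lt0r cmod_ge0 andbT; apply: contra detU.
  by move=> /eqP/ComplexField.Normc.eq0_normc ->.
(* The tolerance carries [|det U|] because [det (D h)] is [det B(mu + h)] times the nonzero constant
   [det U]. *)
have [s s0 Hs] := det_littleo (mulr_ge0 L0 c0) r0 HD D00 wn0 Dw (mulr_gt0 e0 dU0).
exists s => // h hs; rewrite detB subr0 mul0r subr0.
have := Hs h hs; rewrite /D det_mulmx cmodM mulrAC ler_pM2r//.
Qed.

End SimpleKernel.

(* The remainder O(|mu - lam|^2) is uniform in the subspace (of any dimension
   m) and in the Ritz pair; its constant K depends on T, lam, xs and on a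
   positive lower bound s0 of sigma_min (C lam). *)
Theorem theorem3p3 (R : realType) (n : nat) (Omega : set R[i])
    (T : R[i] -> 'M[R[i]]_n) (lam : R[i]) (xs : 'cV[R[i]]_n) :
  open (Omega : set R[i]^o) -> connected (Omega : set R[i]^o) ->
  analytic_on Omega T ->
  (exists2 l, Omega l & \det (T l) <> 0) ->
  eigenpair Omega T lam xs -> simple_eigenvalue T lam ->
  forall s0 : R, 0 < s0 ->
  exists K delta : R, 0 < delta /\
  forall (m : nat) (W : 'M[R[i]]_(n, m)) (mu : R[i]) (z : 'cV[R[i]]_m)
      (Zp : 'M[R[i]]_(m, m.-1)),
    let B := compression W T in
    let C := compression Zp B in
    let eps := sin_angle_space xs W in
    adjmx W *m W = 1%:M -> eps < 1 ->
    eigenpair Omega B mu z -> unitary (row_mx z Zp) ->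
    simple_eigenvalue B mu ->
    0 < sigma_min (C lam) ->
    (forall z' : 'cV[R[i]]_m, eigenpair Omega B mu z' ->
       exists2 a : R[i], cmod a = 1 & W *m z' = a *: (W *m z)) /\
    (s0 <= sigma_min (C lam) -> cmod (mu - lam) < delta ->
     sin (angle (W *m z) xs) <=
       (1 + mxnorm2 (T lam) / (Num.sqrt (1 - eps ^+ 2) * sigma_min (C lam)))
         * eps
       + mxnorm2 (mxderiv T lam) * cmod (mu - lam) / sigma_min (C lam)
       + K * cmod (mu - lam) ^+ 2).
Proof.
move=> _ _ anT _ [Olam Txs xs1] _ s0 s00.
have [K [r [K0 r0 HK]]] := analytic_mx_taylor (anT lam Olam).
(* The Taylor remainder gets divided by [sigma_min (C lam) >= s0], whence [K / s0]; the Taylor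
   radius serves as [delta]. *)
exists (K / s0), r; split=> // m W mu z Zp B C eps W1 eps1 [Omu Bz z1] Uz simB sig0.
split=> [z' [_ Bz' z'1]|s0C hr].
  have zE := simple_eigenvalue_ker (anT mu Omu) W1 z1 Uz simB Bz Bz'.
  exists ((adjmx z *m z') ord0 ord0); last by rewrite {1}zE scalemxAr.
  by have := congr1 vnorm zE; rewrite vnormZ z1 z'1 mulr1.
have eps0 : 0 <= eps by exact: vnorm_ge0.
pose b := cmod (mu - lam) * mxnorm2 (mxderiv T lam) + K * cmod (mu - lam) ^+ 2.
have hb : vnorm ((T mu - T lam) *m (W *m z)) <= b.
  have := HK _ hr (W *m z); rewrite subrKC (vnorm_isometry _ W1) z1 mulr1 => h.
  rewrite -[T mu - T lam](subrK ((mu - lam) *: mxderiv T lam)) mulmxDl addrC.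
  apply: (le_trans (vnormD _ _)); rewrite lerD// -scalemxAl vnormZ.
  rewrite ler_wpM2l ?cmod_ge0// (le_trans (le_mxnorm2 _ _))//.
  by rewrite (vnorm_isometry _ W1) z1 mulr1.
apply: (le_trans (ritz_angle_bound Txs xs1 W1 Bz z1 Uz sig0 hb)).
rewrite -/(C lam) -/eps /b; set sg := sigma_min (C lam).
set q := Num.sqrt (1 - eps ^+ 2).
have q0 : 0 < q by rewrite sqrtr_gt0 subr_gt0 expr_lt1.
have q1 : q <= 1 by rewrite -[leRHS]sqrtr1 ler_sqrt// gerBl sqr_ge0.
have N0 := mxnorm2_ge0 (T lam).
(* The bound obtained lacks the factor [1 / q]; as [0 < q <= 1], inserting it only enlarges the
   right-hand side. *)
have h1 : mxnorm2 (T lam) * eps / sg <= mxnorm2 (T lam) / (q * sg) * eps.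
  rewrite mulrAC ler_wpM2r// ler_wpM2l// lef_pV2 ?posrE ?mulr_gt0//.
  by rewrite ler_piMl// ltW.
have h2 : K * cmod (mu - lam) ^+ 2 / sg <= K / s0 * cmod (mu - lam) ^+ 2.
  rewrite mulrAC ler_wpM2r ?sqr_ge0// ler_wpM2l// lef_pV2 ?posrE//.
rewrite [leLHS](_ : _ = eps + mxnorm2 (T lam) * eps / sg
    + mxnorm2 (mxderiv T lam) * cmod (mu - lam) / sg
    + K * cmod (mu - lam) ^+ 2 / sg); last by ring.
by rewrite [(1 + _) * _]mulrDl mul1r lerD// lerD2r lerD2l.
Qed.
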